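(* Let $f:\mathbb{R}^n\to\mathbb{R}$ be twice differentiable with $\mu I\preceq \nabla^2 f(x)\preceq L I$ for all $x$ (where $0<\mu\le L$), and strongly self-concordant with constant $M\ge 0$. Let $\kappa=L/\mu$. Run the SR1 method with correction strategy: choose $x_0\in\mathbb{R}^n$, set $G_0=L\cdot I$, $r_{-1}=0$, and for $k=0,1,2,\dots$ set $x_{k+1}=x_k-G_k^{-1}\nabla f(x_k)$, $u_k=x_{k+1}-x_k$, $r_k=\|u_k\|_{x_k}$, $\widetilde G_k=\left(1+\frac{Mr_{k-1}}{2}\right)\left(1+\frac{Mr_k}{2}\right)G_k$, $J_k=\int_0^1\nabla^2 f(x_k+tu_k)\,dt$, and $G_{k+1}=\mathrm{SR1}(J_k,\widetilde G_k,u_k)$. Set also $J_{-1}=\nabla^2 f(x_0)$, $\lambda_k=\lambda_f(x_k)$, and $\xi_k=e^{M\sum_{i=0}^{k-1}(r_{i-1}+r_i)}$ (so $\xi_0=1$). Suppose $M\lambda_0\le\frac{\ln(3/2)}{4\kappa}$. Then for all $k\ge 0$: $$J_{k-1}\preceq G_k\preceq \xi_k\kappa J_{k-1},\qquad e^{Mr_{k-1}/2}\lambda_k\le\left(1-\frac{1}{2\kappa}\right)^k\lambda_0,\qquad r_k\le\left(1-\frac{1}{2\kappa}\right)^k\lambda_0,\qquad \xi_k\le\frac32.$$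
   Context: $f$ is strongly self-concordant with constant $M\ge0$ if $\nabla^2 f(y)-\nabla^2 f(x)\preceq M\|y-x\|_z\nabla^2 f(w)$ for all $x,y,z,w\in\mathbb{R}^n$, where $\|u\|_x=\sqrt{u^\top\nabla^2 f(x)u}$. $\lambda_f(x)=\langle\nabla f(x),[\nabla^2 f(x)]^{-1}\nabla f(x)\rangle^{1/2}$. For symmetric positive definite $A,G$ and $u\neq 0$, $\mathrm{SR1}(A,G,u)=G$ if $(G-A)u=0$, and otherwise $\mathrm{SR1}(A,G,u)=G-\frac{(G-A)uu^\top(G-A)}{u^\top(G-A)u}$. *)

(* Defs.v *)
From HB Require Import structures.
From mathcomp Require Import all_boot all_order all_algebra.
From mathcomp Require Import all_classical all_reals all_analysis.
Set Implicit Arguments. Unset Strict Implicit. Unset Printing Implicit Defensive.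
Import Order.TTheory GRing.Theory Num.Theory.
Import numFieldNormedType.Exports.
Local Open Scope ring_scope.
Local Open Scope classical_set_scope.

Section Defs.
Variables (R : realType) (n : nat).

Definition dotv (u v : 'cV[R]_n) : R := (u^T *m v) 0 0.
Definition qf (A : 'M[R]_n) (u : 'cV[R]_n) : R := (u^T *m A *m u) 0 0.
Definition loewner_le (A B : 'M[R]_n) : Prop := forall v : 'cV[R]_n, qf A v <= qf B v.

Definition is_gradient (f : 'cV[R]_n -> R) (g : 'cV[R]_n -> 'cV[R]_n) : Prop :=
  forall x, differentiable f x /\ forall v, 'D_v f x = dotv (g x) v.
Definition is_hessian (g : 'cV[R]_n -> 'cV[R]_n) (H : 'cV[R]_n -> 'M[R]_n) : Prop :=
  forall x, differentiable g x /\ forall v, 'D_v g x = H x *m v.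

Definition local_norm (H : 'cV[R]_n -> 'M[R]_n) (x u : 'cV[R]_n) : R :=
  Num.sqrt (qf (H x) u).
Definition newton_decr (g : 'cV[R]_n -> 'cV[R]_n) (H : 'cV[R]_n -> 'M[R]_n) (x : 'cV[R]_n) : R :=
  Num.sqrt (dotv (g x) (invmx (H x) *m g x)).

Definition strongly_self_concordant (H : 'cV[R]_n -> 'M[R]_n) (M : R) : Prop :=
  forall x y z w : 'cV[R]_n,
    loewner_le (H y - H x) ((M * local_norm H z (y - x)) *: H w).

Definition SR1 (A G : 'M[R]_n) (u : 'cV[R]_n) : 'M[R]_n :=
  if (G - A) *m u == 0 then G
  else G - (qf (G - A) u)^-1 *: ((G - A) *m u *m u^T *m (G - A)).

Definition hess_int (H : 'cV[R]_n -> 'M[R]_n) (x u : 'cV[R]_n) : 'M[R]_n :=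
  \matrix_(i, j) Rintegral lebesgue_measure `[0%R, 1%R]
                   (fun t : R => H (x + t *: u) i j).

Definition step_u (x : nat -> 'cV[R]_n) (k : nat) : 'cV[R]_n := x k.+1 - x k.
Definition r_seq (H : 'cV[R]_n -> 'M[R]_n) (x : nat -> 'cV[R]_n) (k : nat) : R :=
  local_norm H (x k) (step_u x k).
Definition r_prev H x (k : nat) : R :=
  if k is k'.+1 then r_seq H x k' else 0.
Definition J_seq (H : 'cV[R]_n -> 'M[R]_n) (x : nat -> 'cV[R]_n) (k : nat) : 'M[R]_n :=
  hess_int H (x k) (step_u x k).
Definition J_prev H x (k : nat) : 'M[R]_n :=
  if k is k'.+1 then J_seq H x k' else H (x 0%N).
Definition xi_seq (M : R) H x (k : nat) : R :=
  expR (M * \sum_(i < k) (r_prev H x i + r_seq H x i)).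
Definition Gtilde (M : R) H x (G : nat -> 'M[R]_n) (k : nat) : 'M[R]_n :=
  ((1 + M * r_prev H x k / 2) * (1 + M * r_seq H x k / 2)) *: G k.

End Defs.

(* Main.v *)
(** Writing [kappa = L / mu], [a_k = 1 + M r_{k-1} / 2], [b_k = 1 + M r_k / 2], strong
    self-concordance makes the matrices [J_{k-1}], [H (x k)], [J_k] and [H (x k.+1)]
    comparable with consecutive ratios at most [a_k], [b_k], [b_k]. The correction factor
    [a_k b_k] therefore restores [J_k <= Gtilde_k], and since an SR1 update towards [J_k]
    only decreases a matrix above [J_k] while staying above [J_k], the sandwich
    [J_{k-1} <= G_k <= xi_k kappa J_{k-1}] propagates.

    As [g (x k.+1) = g (x k) - J_k G_k^-1 g (x k)], the sandwich bounds the new gradient in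
    the norm of [J_k^-1] by [q = 1 - 2 / (3 kappa)] times the old one, as long as
    [xi_{k+1} <= 3/2]. The changes of norm cost at most [exp (ln (3/2) / (4 kappa))], which
    turns [q] into [1 - 1 / (2 kappa)]. Summing the resulting geometric bounds on [r_i] gives
    [xi_{k+1} <= 3/2] back. *)

Require Import Defs.
From HB Require Import structures.
From mathcomp Require Import all_boot all_order all_algebra.
From mathcomp Require Import all_classical all_reals all_analysis.
From mathcomp Require Import ring lra.
Import Order.TTheory GRing.Theory Num.Theory.
Import numFieldNormedType.Exports.
Local Open Scope ring_scope.

(** * Quadratic forms and the Loewner order *)

Section LinearAlgebra.
Set Implicit Arguments. Unset Strict Implicit.
Variables (R : realType) (n : nat).
Implicit Types (u v w : 'cV[R]_n) (A B C G J : 'M[R]_n) (c d q : R).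

Lemma dotvE u v : dotv u v = \sum_i u i 0 * v i 0.
Proof. by rewrite /dotv mxE; apply: eq_bigr => i _; rewrite mxE. Qed.

Lemma dotvC u v : dotv u v = dotv v u.
Proof. by rewrite !dotvE; apply: eq_bigr => i _; rewrite mulrC. Qed.

Lemma dotvDr u v w : dotv u (v + w) = dotv u v + dotv u w.
Proof. by rewrite /dotv mulmxDr mxE. Qed.

Lemma dotvZr c u v : dotv u (c *: v) = c * dotv u v.
Proof. by rewrite /dotv -scalemxAr mxE. Qed.

Lemma dotvNr u v : dotv u (- v) = - dotv u v.
Proof. by rewrite /dotv mulmxN mxE. Qed.

Lemma dotvDl u v w : dotv (v + w) u = dotv v u + dotv w u.
Proof. by rewrite dotvC dotvDr !(dotvC u). Qed.

Lemma dotvZl c u v : dotv (c *: v) u = c * dotv v u.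
Proof. by rewrite dotvC dotvZr dotvC. Qed.

Lemma dotvNl u v : dotv (- v) u = - dotv v u.
Proof. by rewrite dotvC dotvNr dotvC. Qed.

Definition dotv_lin := (dotvDr, dotvDl, dotvZr, dotvZl, dotvNr, dotvNl).

Lemma dotv_mulmx A u v : dotv u (A *m v) = dotv (A^T *m u) v.
Proof. by rewrite /dotv trmx_mul trmxK mulmxA. Qed.

Lemma dotvv_ge0 u : 0 <= dotv u u.
Proof. by rewrite dotvE sumr_ge0// => i _; rewrite -expr2 sqr_ge0. Qed.

Lemma dotvv_gt0 u : u != 0 -> 0 < dotv u u.
Proof.
move=> u0; rewrite lt_neqAle dotvv_ge0 andbT eq_sym; apply: contraNN u0.
rewrite dotvE psumr_eq0 => [|i _]; last by rewrite -expr2 sqr_ge0.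
move/allP => u0; apply/eqP/matrixP => i j; rewrite (ord1 j) mxE.
by have := u0 i (mem_index_enum i); rewrite -expr2 sqrf_eq0 => /eqP.
Qed.

Lemma dotv_delta u i : dotv (delta_mx i 0) u = u i 0.
Proof.
rewrite dotvE (bigD1 i)//= big1 => [|j ij]; last by rewrite mxE (negbTE ij) mul0r.
by rewrite mxE !eqxx mul1r addr0.
Qed.

Lemma coef_dotv A i j : A i j = dotv (delta_mx i 0) (A *m delta_mx j 0).
Proof.
rewrite dotv_delta mxE (bigD1 j)//= big1 => [|k kj].
  by rewrite mxE !eqxx mulr1 addr0.
by rewrite mxE (negbTE kj) mulr0.
Qed.

Lemma qfE A u : qf A u = dotv u (A *m u).
Proof. by rewrite /qf /dotv mulmxA. Qed.

Lemma qf_sum A u : qf A u = \sum_i \sum_j u i 0 * A i j * u j 0.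
Proof.
rewrite qfE dotvE; apply: eq_bigr => i _; rewrite mxE mulr_sumr.
by apply: eq_bigr => j _; rewrite mulrA.
Qed.

Lemma qfD A B u : qf (A + B) u = qf A u + qf B u.
Proof. by rewrite !qfE mulmxDl dotvDr. Qed.

Lemma qfN A u : qf (- A) u = - qf A u.
Proof. by rewrite !qfE mulNmx dotvNr. Qed.

Lemma qfZ c A u : qf (c *: A) u = c * qf A u.
Proof. by rewrite !qfE -scalemxAl dotvZr. Qed.

Lemma qf_scalar c u : qf c%:M u = c * dotv u u.
Proof. by rewrite qfE mul_scalar_mx dotvZr. Qed.

Lemma qfZv A c u : qf A (c *: u) = c ^+ 2 * qf A u.
Proof. by rewrite !qfE -scalemxAr !dotv_lin mulrA. Qed.

Lemma qfDv A u v : A^T = A ->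
  qf A (u + v) = qf A u + 2 * dotv u (A *m v) + qf A v.
Proof.
move=> sA; rewrite !qfE mulmxDr !dotv_lin.
have -> : dotv v (A *m u) = dotv u (A *m v) by rewrite dotv_mulmx sA dotvC.
by ring.
Qed.

(** Polarization: self-concordance controls quadratic forms only, and this transfers continuity from
    them to matrix entries. *)
Lemma sym_coef A i j : A^T = A ->
  A i j = (qf A (delta_mx i 0 + delta_mx j 0)
           - qf A (delta_mx i 0) - qf A (delta_mx j 0)) / 2.
Proof.
by move=> sA; rewrite qfDv// -coef_dotv; field.
Qed.

(** Semidefiniteness is the right generality: the form will be the gap between two
    Loewner-comparable matrices, which may be singular. *)
Lemma cauchy_schwarz A u v : A^T = A -> (forall w, 0 <= qf A w) ->
  dotv u (A *m v) ^+ 2 <= qf A u * qf A v.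
Proof.
move=> sA pA; set b := dotv _ _.
have key s t : 0 <= s ^+ 2 * qf A u + 2 * (s * t * b) + t ^+ 2 * qf A v.
  have := pA (s *: u + t *: v).
  by rewrite qfDv// !qfZv -scalemxAr !dotv_lin -/b [s * (t * b)]mulrA.
(* With [a = qf A u] and [c = qf A v], these two choices give [c (a c - b^2) >= 0] and
   [a (a c - b^2) >= 0], enough when [a] or [c] is positive. The choice [(1, -b)] forces [b = 0]
   when both vanish. *)
have := key (qf A v) (- b); have := key (- b) (qf A u).
have := key 1 (- b); have := pA u; have := pA v.
move: (qf A u) (qf A v) => a c c0 a0 h1 h2 h3.
have [a_gt0|a_le0] := ltP 0 a.
  rewrite -subr_ge0 -(pmulr_rge0 _ a_gt0); lra.
have [c_gt0|c_le0] := ltP 0 c.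
  rewrite -subr_ge0 -(pmulr_rge0 _ c_gt0); lra.
have a_eq0 : a = 0 by lra.
have c_eq0 : c = 0 by lra.
rewrite a_eq0 c_eq0 in h1 *; lra.
Qed.

(** * Positive definite matrices and their inverses *)

Definition posdef A := A^T = A /\ forall v, v != 0 -> 0 < qf A v.

Lemma posdef_ge0 A v : posdef A -> 0 <= qf A v.
Proof.
move=> [_ pA]; have [->|/pA/ltW//] := eqVneq v 0.
by rewrite qfE mulmx0 /dotv mulmx0 mxE.
Qed.

Lemma posdef_unitmx A : posdef A -> A \in unitmx.
Proof.
move=> [sA pA]; rewrite unitmxE unitfE; apply/negP => /det0P[v v0 vA0].
have vT0 : v^T != 0 by rewrite -trmx0 (inj_eq (@trmx_inj _ _ _)).
by have := pA _ vT0; rewrite qfE -{1}sA -trmx_mul vA0 trmx0 /dotv mulmx0 mxE ltxx.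
Qed.

Lemma sym_invmx A : A^T = A -> (invmx A)^T = invmx A.
Proof. by move=> sA; rewrite trmx_inv sA. Qed.

Lemma loewner_posdef A B c : 0 < c -> B^T = B -> posdef A ->
  loewner_le A (c *: B) -> posdef B.
Proof.
move=> c0 sB [sA pA] AB; split=> // v v0.
by rewrite -(pmulr_rgt0 _ c0) -qfZ (lt_le_trans (pA _ v0)).
Qed.

Lemma loewner_trans B A C : loewner_le A B -> loewner_le B C -> loewner_le A C.
Proof. by move=> AB BC v; apply: le_trans (AB v) (BC v). Qed.

Lemma loewnerZ A B c d : 0 <= c ->
  loewner_le A (d *: B) -> loewner_le (c *: A) ((c * d) *: B).
Proof. by move=> c0 AB v; have := AB v; rewrite !qfZ -mulrA; exact: ler_wpM2l. Qed.

Lemma loewner_weaken A B c d : (forall v, 0 <= qf B v) -> c <= d ->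
  loewner_le A (c *: B) -> loewner_le A (d *: B).
Proof.
by move=> pB cd AB v; rewrite (le_trans (AB v))// !qfZ ler_wpM2r.
Qed.

Lemma loewner_inv A B c : 0 < c -> posdef A -> posdef B ->
  loewner_le A (c *: B) -> loewner_le (invmx B) (c *: invmx A).
Proof.
move=> c0 pA pB AB v; rewrite qfZ !qfE.
have uA := posdef_unitmx pA; have uB := posdef_unitmx pB.
set a := invmx A *m v; set b := invmx B *m v.
have Aa : A *m a = v by rewrite mulKVmx.
have Bb : B *m b = v by rewrite mulKVmx.
have qfa : qf A a = dotv v a by rewrite qfE Aa dotvC.
have qfb : qf A b <= c * dotv v b by have := AB b; rewrite qfZ !qfE Bb [dotv b v]dotvC.
have cross : dotv a (A *m b) = dotv v b by rewrite dotv_mulmx (proj1 pA) Aa.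
(* [0 <= |c a - b|_A^2] is the claim, because [<a, A b> = <v, b>]. *)
have := posdef_ge0 (c *: a - b) pA.
rewrite qfDv ?(proj1 pA)// qfZv -scaleN1r qfZv -scalemxAr !dotv_lin cross qfa => h.
rewrite -subr_ge0 -(pmulr_rge0 _ c0); lra.
Qed.

(** The hypotheses say that [J^(1/2) (J^-1 - G^-1) J^(1/2)] has operator norm at most [q]; the
    conclusion applies this to [J^(-1/2) v]. The argument avoids matrix square roots. *)
Lemma invmx_form_contract J G q v : posdef J -> posdef G -> 0 < q ->
  loewner_le ((1 - q) *: invmx J) (invmx G) ->
  loewner_le (invmx G) ((1 + q) *: invmx J) ->
  qf (invmx J) (v - J *m (invmx G *m v)) <= q ^+ 2 * qf (invmx J) v.
Proof.
move=> pJ pG q0 lo hi.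
have uJ := posdef_unitmx pJ.
have sJ : (invmx J)^T = invmx J by apply: sym_invmx; exact: (proj1 pJ).
have sG : (invmx G)^T = invmx G by apply: sym_invmx; exact: (proj1 pG).
(* Polarization: test [|S| <= q J^-1] on [q v + z] and [q v - z], where [J^-1 z = S v]. *)
pose S := invmx J - invmx G.
have sS : S^T = S by rewrite /S linearB/= sJ sG.
have Slo w : - (q * qf (invmx J) w) <= qf S w.
  by have := hi w; rewrite qfZ qfD qfN; lra.
have Shi w : qf S w <= q * qf (invmx J) w.
  by have := lo w; rewrite qfZ qfD qfN; lra.
pose z := v - J *m (invmx G *m v).
have zE : invmx J *m z = S *m v by rewrite mulmxBr mulKmx// mulmxBl.
rewrite -/z; clearbody z.
have := Shi (q *: v + z); have := Slo (q *: v - z).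
have qz : dotv v (S *m z) = qf (invmx J) z.
  by rewrite qfE zE dotv_mulmx sS dotvC.
rewrite !qfDv// -(scaleN1r z) !qfZv -!scalemxAr !dotv_lin qz => h1 h2.
(* Write [N] for the form of [J^-1]. Subtracting the two tests cancels its cross terms and leaves
   [4 q N(z) <= 2 q (q^2 N(v) + N(z))]. *)
rewrite -subr_ge0 -(pmulr_rge0 _ q0); lra.
Qed.

(** * The SR1 update in the Loewner order *)

Lemma qf_rank1 B u v : qf (B *m u *m u^T *m B) v = dotv v (B *m u) * dotv u (B *m v).
Proof.
rewrite /qf /dotv.
have -> : v^T *m (B *m u *m u^T *m B) *m v = (v^T *m (B *m u)) *m (u^T *m (B *m v)).
  by rewrite !mulmxA.
by rewrite mxE big_ord1.
Qed.

Lemma sym_SR1 A G u : A^T = A -> G^T = G -> (SR1 A G u)^T = SR1 A G u.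
Proof.
move=> sA sG; rewrite /SR1; case: ifP => // _.
rewrite linearB/= linearZ/= !trmx_mul trmxK !linearB/= sA sG !mulmxA//.
Qed.

(** The subtracted term is [w w^T] with [w = (G - A) u], times a nonnegative scalar. *)
Lemma SR1_le A G u : A^T = A -> G^T = G -> loewner_le A G ->
  loewner_le (SR1 A G u) G.
Proof.
move=> sA sG AG v; rewrite /SR1; case: ifP => // _.
have sB : (G - A)^T = G - A by rewrite linearB/= sA sG.
have c0 : 0 <= (qf (G - A) u)^-1 by rewrite invr_ge0 qfD qfN subr_ge0.
move: (_^-1) c0 => c c0; rewrite qfD qfN qfZ qf_rank1 gerBl mulr_ge0//.
by rewrite [dotv u _]dotv_mulmx sB [dotv _ v]dotvC -expr2 sqr_ge0.
Qed.

(** Cauchy-Schwarz for the semidefinite form [G - A] bounds the rank-one term by [G - A] itself. *)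
Lemma SR1_ge A G u : A^T = A -> G^T = G -> loewner_le A G ->
  loewner_le A (SR1 A G u).
Proof.
move=> sA sG AG v; rewrite /SR1; case: ifP => // _.
have sB : (G - A)^T = G - A by rewrite linearB/= sA sG.
have pB w : 0 <= qf (G - A) w by rewrite qfD qfN subr_ge0.
have CS := cauchy_schwarz v u sB pB; have u0 := pB u.
have vE : qf (G - A) v = qf G v - qf A v by rewrite qfD qfN.
move: (qf _ u) u0 CS => c u0 CS.
rewrite qfD qfN qfZ qf_rank1 [dotv u _]dotv_mulmx sB [dotv _ v]dotvC -expr2.
move: (dotv v _) CS => d CS.
(* If the denominator is zero, its inverse is zero by convention and nothing is subtracted. *)
have := u0; rewrite le_eqVlt => /predU1P[<-|c0].
  by rewrite invr0 mul0r subr0.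
suff : c^-1 * d ^+ 2 <= qf (G - A) v by rewrite vE; lra.
by rewrite mulrC ler_pdivrMr.
Qed.

End LinearAlgebra.

(** * Symmetry of the Hessian *)

Section LineDerivatives.
Set Implicit Arguments. Unset Strict Implicit.
Variables (R : realType).

Lemma is_derive_line (V W : normedModType R) (F : V -> W) (x u : V) (t : R) :
  differentiable F (x + t *: u) ->
  is_derive t (1 : R) (fun s : R => F (x + s *: u)) ('D_u F (x + t *: u)).
Proof.
move=> dF.
have E : (fun h : R => h^-1 *: (F (x + (h *: (1 : R) + t) *: u) - F (x + t *: u)))
   = (fun h : R => h^-1 *: (F (h *: u + (x + t *: u)) - F (x + t *: u))).
  apply/funext => h; congr (_ *: (F _ - _)).
  by rewrite scalerDl addrCA [_%:A]mulr1.
have dFu : derivable F (x + t *: u) u by exact: diff_derivable.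
apply: DeriveDef.
  by move: dFu; rewrite /derivable E.
by rewrite /derive E.
Qed.

Lemma is_derive_coord (n : nat) (F : R -> 'cV[R]_n) (t : R) (dF : 'cV[R]_n) i :
  is_derive t (1 : R) F dF -> is_derive t (1 : R) (fun s => F s i 0) (dF i 0).
Proof.
move=> [dFt <-]; apply: DeriveDef; first exact: (derivable_mxP _ _ _).1.
by rewrite derive_mx// mxE.
Qed.

Lemma MVT_ex (F dF : R -> R) (t : R) : 0 < t ->
  (forall s, is_derive s (1 : R) F (dF s)) ->
  exists2 c, 0 < c < t & F t - F 0 = dF c * t.
Proof.
move=> t0 DF.
have [|c] := @MVT R F dF 0 t t0 (fun s _ => DF s).
  apply: derivable_within_continuous => s _; exact: (@ex_derive _ _ _ _ _ _ _ (DF s)).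
by rewrite in_itv/= subr0 => c0t FE; exists c.
Qed.

Lemma differentiable_approx (V W : normedModType R) (F : V -> W) (x : V) (e : R) :
  differentiable F x -> 0 < e ->
  exists2 d, 0 < d & forall h, `|h| < d ->
    `|F (x + h) - F x - 'd F x h| <= e * `|h|.
Proof.
move=> dF e0.
have /eqaddoP /(_ e e0) := diff_locally dF.
move=> /nbhs_ballP[d /= d0 dle]; exists d => // h hd.
have : ball (0 : V) d h by rewrite -ball_normE/= sub0r normrN.
by move=> /dle/=; rewrite /= !fctE/= opprD addrA [h + x]addrC.
Qed.

End LineDerivatives.

Section Schwarz.
Set Implicit Arguments. Unset Strict Implicit.
Variables (R : realType) (n : nat).
Variables (f : 'cV[R]_n -> R) (g : 'cV[R]_n -> 'cV[R]_n) (H : 'cV[R]_n -> 'M[R]_n).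
Hypothesis fg : is_gradient f g.
Hypothesis gH : is_hessian g H.

Lemma hessian_approx x e : 0 < e ->
  exists2 d, 0 < d & forall h, `|h| < d ->
    `|g (x + h) - g x - H x *m h| <= e * `|h|.
Proof.
move=> e0; have [dg Dg] := gH x.
have [d d0 dle] := differentiable_approx dg e0.
by exists d => // h /dle; rewrite -deriveE// Dg.
Qed.

Lemma dotv_norm_le (u v : 'cV[R]_n) : `|dotv u v| <= n%:R * `|u| * `|v|.
Proof.
rewrite dotvE (le_trans (ler_norm_sum _ _ _))//.
have -> : n%:R * `|u| * `|v| = \sum_(i < n) `|u| * `|v|.
  by rewrite sumr_const card_ord -mulrA mulr_natl.
apply: ler_sum => i _; rewrite normrM.
have coord_le (w : 'cV[R]_n) : `|w i 0| <= `|w|.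
  rewrite [leRHS]mx_normrE.
  exact: (le_bigmax 0 (fun ij => `|w ij.1 ij.2|) (i, 0)).
exact: ler_pM.
Qed.


(** The difference quotient is symmetric in [u] and [v] while its limit is the Hessian form; this is
    the input to the symmetry of [H]. *)
Lemma second_difference x (u v : 'cV[R]_n) e : 0 < e ->
  exists2 d, 0 < d & forall t, 0 < t < d ->
    `|f (x + t *: v + t *: u) - f (x + t *: u) - f (x + t *: v) + f x
      - t ^+ 2 * dotv u (H x *m v)| <= e * t ^+ 2.
Proof.
move=> e0; pose K := `|u| + `|v| + 1.
have K1 : 1 <= K by rewrite /K; have := normr_ge0 u; have := normr_ge0 v; lra.
have K0 : 0 < K by lra.
have uK : `|u| <= K by rewrite /K; have := normr_ge0 v; lra.
have vuK : `|v| + `|u| <= K by rewrite /K; lra.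
(* The final error is [2 n K^2 (e / c1) t^2], so this [c1] brings it below [e t^2]; the added 1
   keeps [c1] positive when [n = 0]. *)
pose c1 := n%:R * K * K * 2 + 1 : R.
have c10 : 0 < c1 by rewrite ltr_wpDl// !mulr_ge0// ltW.
have [d d0 gle] := hessian_approx x (divr_gt0 e0 c10).
exists (d / K) => [|t /andP[t0]]; first exact: divr_gt0.
rewrite ltr_pdivlMr// => tK.
(* The mean value theorem in direction [u] reduces the second difference to
   [t <u, g (x + t v + c u) - g (x + c u)>], to which differentiability of [g] at [x] applies. *)
pose F s := f (x + t *: v + s *: u) - f (x + s *: u).
have DF s : is_derive s (1 : R) F
    (dotv u (g (x + t *: v + s *: u) - g (x + s *: u))).
  have fu y : 'D_u f y = dotv u (g y) by have [_ ->] := fg y; rewrite dotvC.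
  rewrite dotvDr dotvNr -!fu.
  by apply: is_deriveB; apply: is_derive_line; have [] := fg (x + s *: u);
    have [] := fg (x + t *: v + s *: u).
have [c /andP[c0 ct]] := MVT_ex t0 DF.
have E : F t - F 0 = f (x + t *: v + t *: u) - f (x + t *: u) - f (x + t *: v) + f x.
  by rewrite /F scale0r !addr0; ring.
rewrite -E => ->.
have h1n : `|t *: v + c *: u| <= t * K.
  rewrite (le_trans (ler_normD _ _))// !normrZ !gtr0_norm//.
  rewrite (le_trans _ (ler_wpM2l (ltW t0) vuK))// mulrDr lerD2l.
  by rewrite ler_wpM2r// ltW.
have h2n : `|c *: u| <= t * K.
  by rewrite normrZ gtr0_norm// ler_pM// ltW.
have := gle _ (le_lt_trans h1n tK); have := gle _ (le_lt_trans h2n tK).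
rewrite addrA.
set y1 := g (_ + _ + _); set y2 := g (_ + _) => y2le y1le.
pose r1 := y1 - g x - H x *m (t *: v + c *: u).
pose r2 := y2 - g x - H x *m (c *: u).
have -> : y1 - y2 = t *: (H x *m v) + (r1 - r2).
  rewrite /r1 /r2 mulmxDr -scalemxAr opprD; apply/matrixP => i j; rewrite !mxE; ring.
have r1le : `|r1| <= e / c1 * (t * K).
  by apply: le_trans y1le _; rewrite ler_wpM2l// ltW// divr_gt0.
have r2le : `|r2| <= e / c1 * (t * K).
  by apply: le_trans y2le _; rewrite ler_wpM2l// ltW// divr_gt0.
rewrite dotvDr dotvZr.
have -> : (t * dotv u (H x *m v) + dotv u (r1 - r2)) * t - t ^+ 2 * dotv u (H x *m v)
  = dotv u (r1 - r2) * t by ring.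
rewrite normrM (gtr0_norm t0) expr2 mulrA ler_wpM2r ?(ltW t0)//.
rewrite (le_trans (dotv_norm_le _ _))//.
have r12 : `|r1 - r2| <= e / c1 * (t * K) * 2.
  by rewrite (le_trans (ler_normB _ _))//; lra.
apply: (@le_trans _ _ (n%:R * K * (e / c1 * (t * K) * 2))).
  by apply: ler_pM => //; rewrite ?mulr_ge0// ler_wpM2l.
have -> : n%:R * K * (e / c1 * (t * K) * 2) = (e * t) * ((n%:R * K * K * 2) / c1).
  by field; rewrite gt_eqF.
rewrite ler_piMr ?mulr_ge0 ?(ltW e0) ?(ltW t0)// ler_pdivrMr// /c1; lra.
Qed.

(** Both orders of [u] and [v] approximate the same second difference within [(e / 2) t^2] at a
    common [t], so the two Hessian values differ by at most [e]. *)
Lemma hessian_sym x : (H x)^T = H x.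
Proof.
have form_sym (u v : 'cV[R]_n) : dotv u (H x *m v) = dotv v (H x *m u).
  apply/eqP; rewrite -subr_eq0 -normr_le0; apply/ler_addgt0Pr => e e0.
  have e2 : 0 < e / 2 by rewrite divr_gt0.
  have [d1 d10 D1] := second_difference x u v e2.
  have [d2 d20 D2] := second_difference x v u e2.
  pose t := Num.min d1 d2 / 2.
  have m0 : 0 < Num.min d1 d2 by rewrite lt_min d10.
  have t0 : 0 < t by rewrite divr_gt0.
  have tm : t < Num.min d1 d2 by rewrite /t; lra.
  have := tm; rewrite lt_min => /andP[t1 t2].
  have := D2 t; rewrite t0 t2 => /(_ isT); have := D1 t; rewrite t0 t1 => /(_ isT).
  rewrite [x + t *: u + t *: v]addrAC.
  move: (f _) (f (x + t *: u)) (f (x + t *: v)) (f x) => a b c k.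
  rewrite !ler_norml add0r => /andP[l1 u1] /andP[l2 u2].
  have t20 : 0 < t ^+ 2 by rewrite exprn_gt0.
  by apply/andP; split; rewrite -subr_ge0 -(pmulr_rge0 _ t20); lra.
apply/matrixP => i j; rewrite mxE.
by rewrite !coef_dotv form_sym.
Qed.

End Schwarz.

(** * Averaged Hessians *)

Section UnitIntervalIntegral.
Set Implicit Arguments. Unset Strict Implicit.
Local Open Scope classical_set_scope.
Variable R : realType.
Implicit Types p q : R -> R.

Local Notation I p := (Rintegral (@lebesgue_measure R) `[0%R, 1%R] p).

Lemma continuous_integrable01 p : continuous p ->
  (@lebesgue_measure R).-integrable `[0%R, 1%R] (EFin \o p).
Proof.
move=> cp; apply: continuous_compact_integrable; first exact: segment_compact.
exact: continuous_subspaceT.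
Qed.

Lemma Rintegral01D p q : continuous p -> continuous q ->
  I (fun t => p t + q t) = I p + I q.
Proof. by move=> cp cq; rewrite RintegralD//; exact: continuous_integrable01. Qed.

Lemma Rintegral01Z c p : continuous p -> I (fun t => c * p t) = c * I p.
Proof. by move=> cp; rewrite RintegralZl//; exact: continuous_integrable01. Qed.

Lemma continuousZ_fun c p : continuous p -> continuous (fun t => c * p t).
Proof. by move=> cp t; apply: cvgM; [exact: cvg_cst|exact: cp]. Qed.

Lemma continuous_sum_fun (n : nat) (p : 'I_n -> R -> R) : (forall i, continuous (p i)) ->
  continuous (fun t => \sum_i p i t).
Proof.
elim: n p => [|n IH] p cp t.
  by under eq_fun do rewrite big_ord0; exact: cvg_cst.
under eq_fun do rewrite big_ord_recl.
by apply: cvgD; [exact: cp|exact: IH].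
Qed.

Lemma Rintegral01_sum (n : nat) (p : 'I_n -> R -> R) : (forall i, continuous (p i)) ->
  I (fun t => \sum_i p i t) = \sum_i I (p i).
Proof.
elim: n p => [|n IH] p cp.
  rewrite big_ord0; under eq_Rintegral do rewrite big_ord0.
  by rewrite Rintegral_cst//= mul0r.
rewrite big_ord_recl -IH//; under eq_Rintegral do rewrite big_ord_recl.
by rewrite Rintegral01D//; exact: continuous_sum_fun.
Qed.

Lemma le_Rintegral01 p q : continuous p -> continuous q ->
  (forall t, 0 <= t <= 1 -> p t <= q t) -> I p <= I q.
Proof.
move=> cp cq pq; by apply: le_Rintegral => //; exact: continuous_integrable01.
Qed.

Lemma Rintegral01_FTC p (F : R -> R) : continuous p ->
  (forall t, is_derive t (1 : R) F (p t)) -> I p = F 1 - F 0.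
Proof.
move=> cp DF; have dF t : derivable F t 1 by exact: (@ex_derive _ _ _ _ _ _ _ (DF t)).
have cF : continuous F.
  by move=> t; apply/differentiable_continuous/derivable1_diffP.
rewrite /Rintegral (@continuous_FTC2 _ p F)//.
- exact: continuous_subspaceT.
- split => //.
  + exact/cvg_at_right_filter/cF.
  + exact/cvg_at_left_filter/cF.
- by move=> t _; rewrite derive1E; apply: derive_val.
Qed.

Lemma continuous_affine (a b : R) : continuous (fun t : R => a + b * t).
Proof.
by move=> t; apply: cvgD; [exact: cvg_cst|apply: cvgM; [exact: cvg_cst|exact: cvg_id]].
Qed.

Lemma Rintegral01_affine (a b : R) : I (fun t => a + b * t) = a + b / 2.
Proof.
pose F : R -> R := a \*: id + (b / 2) \*: (id ^+ 2).
have DF t : is_derive t (1 : R) F (a + b * t).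
  by apply: is_derive_eq; rewrite /GRing.scale/=; field.
rewrite (Rintegral01_FTC (@continuous_affine a b) DF) /F !fctE/= /GRing.scale/=.
by rewrite /GRing.exp/=; ring.
Qed.

Lemma Rintegral01_le_affine p (a b : R) : continuous p ->
  (forall t, 0 <= t <= 1 -> p t <= a + b * t) -> I p <= a + b / 2.
Proof.
move=> cp pab; rewrite -Rintegral01_affine.
by apply: le_Rintegral01 => //; exact: continuous_affine.
Qed.

Lemma Rintegral01_ge_affine p (a b : R) : continuous p ->
  (forall t, 0 <= t <= 1 -> a + b * t <= p t) -> a + b / 2 <= I p.
Proof.
move=> cp pab; rewrite -Rintegral01_affine.
by apply: le_Rintegral01 => //; exact: continuous_affine.
Qed.

(** Exchanging [s] and [t] makes the one-sided bound two-sided. The constant [|C| + 1] is positive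
    whatever the sign of [C]. *)
Lemma lipschitz_continuous p (C : R) :
  (forall s t, p t - p s <= C * `|t - s|) -> continuous p.
Proof.
move=> lip t; apply/cvgrPdist_le => e e0.
have C0 : 0 < `|C| + 1 by rewrite ltr_wpDl.
near=> s.
have Cts : C * `|t - s| <= e.
  apply: (@le_trans _ _ ((`|C| + 1) * `|t - s|)).
    by rewrite ler_wpM2r// (le_trans (ler_norm _))// lerDl.
  rewrite -ler_pdivlMl//; near: s; apply: cvgr_dist_le; first exact: cvg_id.
  by rewrite mulrC divr_gt0.
rewrite ler_norml; have := lip s t; have := lip t s; rewrite distrC; lra.
Unshelve. all: by end_near. Qed.

(* In the lower bound the right-hand side may be evaluated at any [s]: integrating over [s]
   first is what gives [y <= (1 + K / 2) I p] rather than [1 / (1 - K / 2)]. *)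
Lemma Rintegral01_average_bounds p (y K a b : R) : continuous p -> a + b / 2 = 1 / 2 ->
  (forall t, 0 <= t <= 1 -> p t - y <= K * (a + b * t) * y) ->
  (forall t s, 0 <= t <= 1 -> y - p t <= K * (a + b * t) * p s) ->
  I p <= (1 + K / 2) * y /\ y <= (1 + K / 2) * I p.
Proof.
move=> cp ab hi lo; split.
  have -> : (1 + K / 2) * y = (y + K * a * y) + K * b * y / 2.
    have -> : (1 + K / 2) * y = y + K * (1 / 2) * y by field.
    by rewrite -ab; field.
  by apply: Rintegral01_le_affine => // t /hi; lra.
have lo' t : 0 <= t <= 1 -> y - p t <= K * (a + b * t) * I p.
  move=> t01; rewrite -Rintegral01Z//.
  have -> : y - p t = (y - p t) + 0 / 2 by rewrite mul0r addr0.
  apply: Rintegral01_ge_affine => [|s _]; first exact: continuousZ_fun.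
  by rewrite mul0r addr0; exact: lo.
have : (y - K * a * I p) + - (K * b * I p) / 2 <= I p.
  by apply: Rintegral01_ge_affine => // t /lo'; lra.
have -> : (1 + K / 2) * I p = I p + K * (1 / 2) * I p by field.
by rewrite -ab; lra.
Qed.

End UnitIntervalIntegral.

(** * Hessians along a segment and their average *)

Section HessianAverage.
Set Implicit Arguments. Unset Strict Implicit.
Variables (R : realType) (n : nat).
Variables (g : 'cV[R]_n -> 'cV[R]_n) (H : 'cV[R]_n -> 'M[R]_n) (M : R).
Hypothesis gH : is_hessian g H.
Hypothesis symH : forall x, (H x)^T = H x.
Hypothesis scH : strongly_self_concordant H M.
Implicit Types x u v w : 'cV[R]_n.

Lemma local_normZ x (c : R) u : local_norm H x (c *: u) = `|c| * local_norm H x u.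
Proof. by rewrite /local_norm qfZv sqrtrM ?sqr_ge0// sqrtr_sqr. Qed.

(** Taking [z = x] measures every displacement along the line in one fixed norm, so that its length
    is linear in [|t - s|]; [w] stays free. *)
Lemma sc_line x u v w (s t : R) :
  qf (H (x + t *: u)) v - qf (H (x + s *: u)) v
    <= M * (`|t - s| * local_norm H x u) * qf (H w) v.
Proof.
have := scH (x + s *: u) (x + t *: u) x w v; rewrite qfD qfN qfZ -local_normZ.
by rewrite opprD addrACA subrr add0r -scalerBl.
Qed.

Lemma qf_line_continuous x u v : continuous (fun t : R => qf (H (x + t *: u)) v).
Proof.
apply: (@lipschitz_continuous _ _ (M * local_norm H x u * qf (H x) v)) => s t.
by have := sc_line x u v x s t; lra.
Qed.

Lemma hess_coef_continuous x u i j : continuous (fun t : R => H (x + t *: u) i j).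
Proof.
under eq_fun do rewrite sym_coef//.
move=> t; apply: cvgM; last exact: cvg_cst.
by apply: cvgB; [apply: cvgB|]; exact: qf_line_continuous.
Qed.

Lemma sym_hess_int x u : (hess_int H x u)^T = hess_int H x u.
Proof.
apply/matrixP => i j; rewrite !mxE; congr Rintegral; apply/funext => t.
by rewrite -[in LHS]symH mxE.
Qed.

(** The integral is entrywise and the form is a finite combination of continuous entries. Loewner
    bounds on the average thus become scalar integral bounds. *)
Lemma qf_hess_int x u v :
  qf (hess_int H x u) v = Rintegral lebesgue_measure `[0%R, 1%R]%classic
    (fun t : R => qf (H (x + t *: u)) v).
Proof.
have cH := @hess_coef_continuous x u.
have E t : qf (H (x + t *: u)) v = \sum_i \sum_j (v i 0 * v j 0) * H (x + t *: u) i j.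
  by rewrite qf_sum; apply: eq_bigr => i _; apply: eq_bigr => j _; rewrite mulrAC.
under eq_Rintegral do rewrite E.
rewrite Rintegral01_sum => [|i]; last first.
  by apply: continuous_sum_fun => j; exact: continuousZ_fun.
rewrite qf_sum; apply: eq_bigr => i _.
rewrite Rintegral01_sum => [|j]; last exact: continuousZ_fun.
by apply: eq_bigr => j _; rewrite Rintegral01Z// mxE mulrAC.
Qed.

(** The secant equation, by the fundamental theorem of calculus in each coordinate of [g] along the
    segment. *)
Lemma hess_int_mul x u : hess_int H x u *m u = g (x + u) - g x.
Proof.
have cH := @hess_coef_continuous x u.
apply/matrixP => i j; rewrite ord1 !mxE.
have DF t : is_derive t (1 : R) (fun s : R => g (x + s *: u) i 0)
    (\sum_k u k 0 * H (x + t *: u) i k).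
  have [dg Dg] := gH (x + t *: u).
  apply: is_derive_eq (is_derive_coord i (is_derive_line dg)) _.
  by rewrite Dg mxE; apply: eq_bigr => k _; rewrite mulrC.
have cu k : continuous (fun t : R => u k 0 * H (x + t *: u) i k) by exact: continuousZ_fun.
have := Rintegral01_FTC (continuous_sum_fun cu) DF.
rewrite Rintegral01_sum// scale1r scale0r addr0 => <-.
by apply: eq_bigr => k _; rewrite Rintegral01Z// mxE mulrC.
Qed.

Lemma hess_int_left x u :
  loewner_le (hess_int H x u) ((1 + M * local_norm H x u / 2) *: H x) /\
  loewner_le (H x) ((1 + M * local_norm H x u / 2) *: hess_int H x u).
Proof.
suff B v : qf (hess_int H x u) v <= (1 + M * local_norm H x u / 2) * qf (H x) v /\
           qf (H x) v <= (1 + M * local_norm H x u / 2) * qf (hess_int H x u) v.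
  by split=> v; rewrite qfZ; have [] := B v.
rewrite qf_hess_int.
(* The weight [0 + 1 t] is the distance from the left endpoint in the segment parameter; its mean is
   1/2. *)
apply: (@Rintegral01_average_bounds _ _ _ _ 0 1).
- exact: qf_line_continuous.
- by rewrite add0r.
- move=> t /andP[t0 _]; have := sc_line x u v x 0 t.
  by rewrite subr0 scale0r addr0 ger0_norm//; lra.
(* The free point [w] is placed on the segment, at the second integration variable [s]. *)
- move=> t s /andP[t0 _]; have := sc_line x u v (x + s *: u) t 0.
  by rewrite sub0r normrN scale0r addr0 ger0_norm//; lra.
Qed.

Lemma hess_int_right x u :
  loewner_le (hess_int H x u) ((1 + M * local_norm H x u / 2) *: H (x + u)) /\
  loewner_le (H (x + u)) ((1 + M * local_norm H x u / 2) *: hess_int H x u).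
Proof.
suff B v : qf (hess_int H x u) v <= (1 + M * local_norm H x u / 2) * qf (H (x + u)) v /\
           qf (H (x + u)) v <= (1 + M * local_norm H x u / 2) * qf (hess_int H x u) v.
  by split=> v; rewrite qfZ; have [] := B v.
rewrite qf_hess_int.
(* From the right endpoint the weight is [1 - t], again of mean 1/2. *)
apply: (@Rintegral01_average_bounds _ _ _ _ 1 (-1)).
- exact: qf_line_continuous.
- by field.
- move=> t /andP[_ t1]; have := sc_line x u v (x + u) 1 t.
  by rewrite scale1r ler0_norm ?subr_le0//; lra.
- move=> t s /andP[_ t1]; have := sc_line x u v (x + s *: u) t 1.
  by rewrite scale1r ger0_norm ?subr_ge0//; lra.
Qed.

Lemma hess_int_ge x u (mu : R) : (forall y, loewner_le mu%:M (H y)) ->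
  loewner_le mu%:M (hess_int H x u).
Proof.
move=> Hmu v; rewrite qf_hess_int.
have -> : qf mu%:M v = qf mu%:M v + 0 / 2 by rewrite mul0r addr0.
apply: Rintegral01_ge_affine => [|t _]; first exact: qf_line_continuous.
by rewrite mul0r addr0; exact: Hmu.
Qed.

End HessianAverage.

(** * The SR1 iteration *)

Section QuasiNewtonStep.
Set Implicit Arguments. Unset Strict Implicit.
Variables (R : realType) (n : nat).
Implicit Types (A G J : 'M[R]_n) (v : 'cV[R]_n).

Lemma posdef_ge_scalar A (mu : R) : 0 < mu -> A^T = A -> loewner_le mu%:M A -> posdef A.
Proof.
move=> mu0 sA muA; split=> // v v0; apply: lt_le_trans (muA v).
by rewrite qf_scalar mulr_gt0// dotvv_gt0.
Qed.

Lemma posdef_inv_ge0 A v : posdef A -> 0 <= qf (invmx A) v.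
Proof.
move=> pA; have := posdef_ge0 (invmx A *m v) pA.
by rewrite !qfE mulKVmx ?posdef_unitmx// dotvC.
Qed.

Lemma le_sqrt_scale (x y c : R) : 0 <= c -> x <= c ^+ 2 * y ->
  Num.sqrt x <= c * Num.sqrt y.
Proof.
move=> c0 /ler_wsqrtr; rewrite sqrtrM ?sqr_ge0// sqrtr_sqr ger0_norm//.
Qed.

(** The comparison [A <= a G] is used twice, directly and inverted as [G^-1 <= a A^-1]; each use
    costs [sqrt a]. *)
Lemma step_length_le A G v (a : R) : 0 < a -> posdef A -> posdef G ->
  loewner_le A (a *: G) ->
  Num.sqrt (qf A (invmx G *m v)) <= a * Num.sqrt (qf (invmx A) v).
Proof.
move=> a0 pA pG AG; apply: le_sqrt_scale; first exact: ltW.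
have := loewner_inv a0 pA pG AG v; rewrite qfZ => h1.
have := AG (invmx G *m v).
have -> : qf (a *: G) (invmx G *m v) = a * qf (invmx G) v.
  by rewrite qfZ !qfE mulKVmx ?posdef_unitmx// dotvC.
move=> h2; apply: le_trans h2 _.
by rewrite expr2 -mulrA ler_wpM2l// ltW.
Qed.

(** The bounds with [d] and [eta] place [G^-1] between [(1 - q) J^-1] and [(1 + q) J^-1], giving
    contraction by [q] in the norm of [J^-1]. Passing from [A^-1] to [J^-1] and then to [B^-1] costs
    [sqrt b] each time. *)
Lemma decrement_contract A B G J v (b d eta q : R) :
  posdef A -> posdef B -> posdef G -> posdef J ->
  0 < b -> 0 < d -> 0 < eta -> 0 < q < 1 ->
  loewner_le J (d *: G) -> d <= 1 + q ->
  loewner_le G (eta *: J) -> (1 - q) * eta <= 1 ->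
  loewner_le A (b *: J) -> loewner_le J (b *: B) ->
  Num.sqrt (qf (invmx B) (v - J *m (invmx G *m v)))
    <= b * q * Num.sqrt (qf (invmx A) v).
Proof.
move=> pA pB pG pJ b0 d0 eta0 /andP[q0 q1] JG dq GJ etaq AJ JB.
apply: le_sqrt_scale; first by rewrite mulr_ge0// ltW.
have lo : loewner_le ((1 - q) *: invmx J) (invmx G).
  move=> w; have := loewner_inv eta0 pG pJ GJ w; rewrite !qfZ => h.
  have q1' : 0 <= 1 - q by lra.
  apply: le_trans (ler_wpM2l q1' h) _.
  by rewrite mulrA ler_piMl// posdef_inv_ge0.
have hi : loewner_le (invmx G) ((1 + q) *: invmx J).
  apply: loewner_weaken dq (loewner_inv d0 pJ pG JG) => w.
  exact: posdef_inv_ge0.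
have h1 := loewner_inv b0 pJ pB JB (v - J *m (invmx G *m v)).
have h2 := invmx_form_contract v pJ pG q0 lo hi.
have h3 := loewner_inv b0 pA pJ AJ v.
rewrite qfZ in h1; rewrite qfZ in h3; apply: (le_trans h1).
have -> : (b * q) ^+ 2 * qf (invmx A) v = b * (q ^+ 2 * (b * qf (invmx A) v)) by ring.
rewrite ler_wpM2l ?(ltW b0)//; apply: (le_trans h2).
by rewrite ler_wpM2l// sqr_ge0.
Qed.

Lemma ln_three_halves_le : ln (3 / 2) <= (1 / 2 : R).
Proof.
have -> : (3 / 2 : R) = 1 + 1 / 2 by field.
by apply: le_ln1Dx; lra.
Qed.

(** From [1 - y <= 1 - s <= exp (- s)]; it trades an exponential for a rational bound. *)
Lemma expR_le_inv (s y : R) : s <= y -> y < 1 -> expR s * (1 - y) <= 1.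
Proof.
move=> sy y1; have h : 1 - y <= expR (- s).
  by have := expR_ge1Dx (- s); lra.
by rewrite (le_trans (ler_wpM2l (expR_ge0 s) h))// expRN divff// gt_eqF// expR_gt0.
Qed.

(** The upper bound pays [c] twice: once for scaling [G], once for replacing [J0] by [J]. *)
Lemma SR1_bounds (J0 J G : 'M[R]_n) (u : 'cV[R]_n) (c eta : R) :
  J^T = J -> G^T = G -> (forall v, 0 <= qf J v) -> 1 <= c -> 0 <= eta ->
  loewner_le J (c *: J0) -> loewner_le J0 (c *: J) ->
  loewner_le J0 G -> loewner_le G (eta *: J0) ->
  loewner_le J (SR1 J (c *: G) u) /\
  loewner_le (SR1 J (c *: G) u) ((c ^+ 2 * eta) *: J).
Proof.
move=> sJ sG pJ c1 eta0 JJ0 J0J J0G GJ0.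
have c0 : 0 <= c by lra.
have scG : (c *: G)^T = c *: G by rewrite linearZ/= sG.
have JcG : loewner_le J (c *: G).
  move=> v; apply: le_trans (JJ0 v) _; rewrite !qfZ ler_wpM2l//; exact: J0G.
split; first exact: SR1_ge.
apply: loewner_trans (SR1_le u sJ scG JcG) _ => v.
have := GJ0 v; have := J0J v; rewrite !qfZ => h1 h2.
have -> : c ^+ 2 * eta * qf J v = c * (eta * (c * qf J v)) by ring.
by rewrite ler_wpM2l// (le_trans h2)// ler_wpM2l.
Qed.

End QuasiNewtonStep.

(** * Induction along the iteration *)

Section Convergence.
Set Implicit Arguments. Unset Strict Implicit.
Variables (R : realType) (n : nat).
Variables (g : 'cV[R]_n -> 'cV[R]_n) (H : 'cV[R]_n -> 'M[R]_n) (mu L M : R).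
Variables (x : nat -> 'cV[R]_n) (G : nat -> 'M[R]_n).
Hypothesis gH : is_hessian g H.
Hypothesis symH : forall y, (H y)^T = H y.
Hypotheses (mu0 : 0 < mu) (muL : mu <= L) (M0 : 0 <= M).
Hypothesis HmuL : forall y, loewner_le (mu%:M) (H y) /\ loewner_le (H y) (L%:M).
Hypothesis scH : strongly_self_concordant H M.
Hypothesis G0 : G 0%N = L%:M.
Hypothesis xS : forall k, x k.+1 = x k - invmx (G k) *m g (x k).
Hypothesis GS :
  forall k, G k.+1 = SR1 (J_seq H x k) (Gtilde M H x G k) (step_u x k).

Let kappa : R := L / mu.
Let lam k : R := newton_decr g H (x k).
Let rho : R := 1 - 1 / (2 * kappa).
Let rp := r_prev H x.
Let r := r_seq H x.
Let S k : R := \sum_(i < k) (rp i + r i).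

Hypothesis start : M * lam 0 <= ln (3 / 2) / (4 * kappa).

Let kappa1 : 1 <= kappa.
Proof. by rewrite /kappa ler_pdivlMr// mul1r. Qed.

Let rho0 : 0 <= rho.
Proof.
rewrite /rho subr_ge0 ler_pdivrMr; have := kappa1; lra.
Qed.

Let rho1 : rho <= 1.
Proof. by rewrite /rho gerBl divr_ge0// mulr_ge0//; have := kappa1; lra. Qed.

Let r_ge0 k : 0 <= r k. Proof. exact: sqrtr_ge0. Qed.

Let rp_ge0 k : 0 <= rp k. Proof. by case: k => [|k] //=; exact: sqrtr_ge0. Qed.

Let lam_ge0 k : 0 <= lam k. Proof. exact: sqrtr_ge0. Qed.

Let posH y : posdef (H y).
Proof. by apply: posdef_ge_scalar mu0 (symH y) _; have [] := HmuL y. Qed.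

Let Jp := J_prev H x.
Let J := J_seq H x.

Let posJ k : posdef (J k).
Proof.
apply: posdef_ge_scalar mu0 _ _; first exact: sym_hess_int.
by apply: (hess_int_ge symH scH) => y; have [] := HmuL y.
Qed.

Let posJp k : posdef (Jp k).
Proof. by case: k => [|k]; [exact: posH|exact: posJ]. Qed.

Let a k : R := 1 + M * rp k / 2.
Let b k : R := 1 + M * r k / 2.

Let a_ge1 k : 1 <= a k.
Proof. by rewrite lerDl divr_ge0// mulr_ge0. Qed.

Let b_ge1 k : 1 <= b k.
Proof. by rewrite lerDl divr_ge0// mulr_ge0. Qed.

Let Jp_near k : loewner_le (Jp k) (a k *: H (x k)) /\ loewner_le (H (x k)) (a k *: Jp k).
Proof.
(* At index 0, [Jp] is [H (x 0)] and [a] is 1, by the conventions for index -1. *)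
case: k => [|k]; first by rewrite /a /rp/= mulr0 mul0r addr0 !scale1r; split=> v.
have := hess_int_right symH scH (x k) (step_u x k).
by rewrite /step_u addrCA subrr addr0.
Qed.

Let J_near k : loewner_le (J k) (b k *: H (x k)) /\ loewner_le (H (x k)) (b k *: J k).
Proof. exact: hess_int_left. Qed.

Let J_near_next k :
  loewner_le (J k) (b k *: H (x k.+1)) /\ loewner_le (H (x k.+1)) (b k *: J k).
Proof. exact: Jp_near k.+1. Qed.

Let loewner_comp A B C (c d : R) : 0 <= c ->
  loewner_le A (c *: B) -> loewner_le B (d *: C) -> loewner_le A ((c * d) *: C : 'M[R]_n).
Proof. by move=> c0 AB BC; apply: loewner_trans AB _; exact: loewnerZ. Qed.

Let lamE k : lam k = Num.sqrt (qf (invmx (H (x k))) (g (x k))).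
Proof. by rewrite /lam /newton_decr qfE. Qed.

Let stepE k : step_u x k = - (invmx (G k) *m g (x k)).
Proof. by rewrite /step_u xS addrAC subrr add0r. Qed.

Let gradE k : g (x k.+1) = g (x k) - J k *m (invmx (G k) *m g (x k)).
Proof.
have xE : x k + step_u x k = x k.+1 by rewrite /step_u addrCA subrr addr0.
have JuE : J k *m step_u x k = g (x k.+1) - g (x k).
  by rewrite -xE; exact: (hess_int_mul gH symH scH).
by rewrite -mulmxN -stepE JuE addrC subrK.
Qed.

Let s0 : R := ln (3 / 2) / (4 * kappa).

(* [S k + rp k] is twice the sum of the [r i], [i < k], bounded by a geometric sum. *)
Let invariant k :=
  [/\ (G k)^T = G k, loewner_le (Jp k) (G k),
      loewner_le (G k) ((xi_seq M H x k * kappa) *: Jp k),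
      expR (M * rp k / 2) * lam k <= rho ^+ k * lam 0 /\ rp k <= lam 0
    & S k + rp k <= 4 * kappa * lam 0 * (1 - rho ^+ k)].

Let rhok k : 0 <= rho ^+ k <= 1.
Proof. by rewrite exprn_ge0//= exprn_ile1. Qed.

Let posG k : invariant k -> posdef (G k).
Proof.
move=> [sG JG _ _ _]; apply: (@loewner_posdef _ _ (Jp k) (G k) 1) => //.
by rewrite scale1r.
Qed.

(** From [H (x k) <= a k Jp k <= a k G k] the step has length at most [a k * lam k]. The exponential
    weight carried by the invariant absorbs [a k]. *)
Let r_le k : invariant k -> r k <= rho ^+ k * lam 0.
Proof.
move=> inv; have [sG JG _ [lamk _] _] := inv; have pG := posG inv.
have a0 : 0 < a k by have := a_ge1 k; lra.
have HG : loewner_le (H (x k)) (a k *: G k).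
  by have [_ h] := Jp_near k; rewrite -[a k]mulr1; apply: loewner_comp h _;
    [exact: ltW|rewrite scale1r].
apply: le_trans lamk.
have := step_length_le (g (x k)) a0 (posH (x k)) pG HG.
rewrite -lamE => h; apply: (@le_trans _ _ (a k * lam k)).
  apply: le_trans h; rewrite /r /r_seq /local_norm stepE.
  by rewrite -scaleN1r qfZv sqrrN expr1n mul1r.
by rewrite ler_wpM2r//; exact: expR_ge1Dx.
Qed.

Let xiE k : xi_seq M H x k = expR (M * S k). Proof. by []. Qed.

Let kappa0 : 0 < kappa. Proof. exact: lt_le_trans ltr01 kappa1. Qed.

Let xi_le k : S k + rp k <= 4 * kappa * lam 0 * (1 - rho ^+ k) ->
  xi_seq M H x k <= 3 / 2.
Proof.
move=> Sk; rewrite xiE.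
have -> : (3 / 2 : R) = expR (ln (3 / 2)) by rewrite lnK// posrE divr_gt0.
rewrite ler_expR.
have k0 : 0 < 4 * kappa by rewrite mulr_gt0.
(* The factor [4 kappa] cancels the denominator in the starting condition. *)
have : S k <= 4 * kappa * lam 0.
  have := rp_ge0 k; have /andP[rk _] := rhok k => h1.
  have : 0 <= 4 * kappa * lam 0 * rho ^+ k by rewrite mulr_ge0// mulr_ge0// ltW.
  lra.
move=> /(ler_wpM2l M0) h; apply: (le_trans h).
by move: start; rewrite ler_pdivlMr// => h2; lra.
Qed.

Let invariant0 : invariant 0.
Proof.
have S0 : S 0 = 0 by rewrite /S big_ord0.
split; rewrite ?G0 ?tr_scalar_mx//.
- by have [] := HmuL (x 0).
- move=> v; rewrite xiE S0 mulr0 expR0 mul1r qfZ !qf_scalar.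
  have := HmuL (x 0) => -[/(_ v) + _]; rewrite qf_scalar.
  move=> /(ler_wpM2l (ltW kappa0)); rewrite mulrA /kappa divfK ?gt_eqF//.
- by rewrite /rp/= mulr0 mul0r expR0 expr0.
- by rewrite S0 /rp/= expr0 subrr mulr0 addr0.
Qed.

(** The left side grows by [2 r k], the right by [4 kappa lam 0 rho^k (1 - rho) = 2 rho^k lam 0],
    since [1 - rho = 1 / (2 kappa)]. *)
Let S_step k : invariant k ->
  S k.+1 + rp k.+1 <= 4 * kappa * lam 0 * (1 - rho ^+ k.+1).
Proof.
move=> inv; have := r_le inv; have [_ _ _ _ Sk] := inv => rk.
have -> : S k.+1 = S k + (rp k + r k) by rewrite /S big_ord_recr.
have -> : rp k.+1 = r k by [].
have -> : 4 * kappa * lam 0 * (1 - rho ^+ k.+1) =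
    4 * kappa * lam 0 * (1 - rho ^+ k) + 2 * (rho ^+ k * lam 0).
  by rewrite exprS /rho; field; rewrite gt_eqF.
lra.
Qed.

Let s0_le : s0 <= kappa^-1 / 8.
Proof.
have k0 : 0 < 4 * kappa by rewrite mulr_gt0.
rewrite /s0 ler_pdivrMr//.
have -> : kappa^-1 / 8 * (4 * kappa) = 1 / 2 by field; rewrite gt_eqF.
exact: ln_three_halves_le.
Qed.

Let ykappa : 0 < kappa^-1 <= 1.
Proof. by rewrite invr_gt0 kappa0 invf_le1. Qed.

(** No circularity arises: the bound 3/2 on [xi] at [k.+1] involves only [r i] with [i <= k],
    already controlled by the invariant at [k]. *)
Let lam_step k : invariant k ->
  expR (M * rp k.+1 / 2) * lam k.+1 <= rho ^+ k.+1 * lam 0.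
Proof.
move=> inv; have xik1 := xi_le (S_step inv); have rk := r_le inv.
have pG := posG inv; have [sG JG GJ [lamk rp0] _] := inv.
have /andP[y0 y1] := ykappa; have s0y := s0_le.
have /andP[rhok0 rhok1] := rhok k.
have rl0 : r k <= lam 0.
  by apply: le_trans rk _; rewrite ler_piMl.
have a1 := a_ge1 k; have b1 := b_ge1 k.
have aexp : a k <= expR (M * rp k / 2) by exact: expR_ge1Dx.
have bexp : b k <= expR (M * r k / 2) by exact: expR_ge1Dx.
have abexp : a k * b k <= expR (M * (rp k + r k) / 2).
  have -> : M * (rp k + r k) / 2 = M * rp k / 2 + M * r k / 2 by field.
  by rewrite expRD ler_pM//; lra.
have Mrp : M * rp k <= s0 by apply: le_trans start; rewrite ler_wpM2l.
have Mr : M * r k <= s0 by apply: le_trans start; rewrite ler_wpM2l.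
have E1 : expR s0 * (1 - kappa^-1 / 8) <= 1 by apply: expR_le_inv => //; lra.
have E0 : 0 < expR s0 by exact: expR_gt0.
have ab_E : a k * b k <= expR s0.
  by apply: le_trans abexp _; rewrite ler_expR; lra.
have ab0 : 0 < a k * b k by rewrite mulr_gt0//; lra.
(* Chosen so that [eta <= 3/2 kappa] yields [(1 - q) eta <= 1]. *)
pose q : R := 1 - 2 / 3 * kappa^-1.
pose eta : R := xi_seq M H x k * kappa * (a k * b k).
have xi0 : 0 < xi_seq M H x k by rewrite xiE expR_gt0.
have JG' : loewner_le (J k) ((a k * b k) *: G k).
  rewrite mulrC -[b k * a k]mulr1; apply: (@loewner_comp _ (Jp k)); first by rewrite mulr_ge0//; lra.
    have [h1 _] := J_near k; have [_ h2] := Jp_near k.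
    by apply: loewner_comp h1 h2; lra.
  by rewrite scale1r.
have GJ' : loewner_le (G k) (eta *: J k).
  apply: loewner_comp GJ _; first by rewrite mulr_ge0// ltW.
  have [_ h1] := J_near k; have [h2 _] := Jp_near k.
  by apply: loewner_comp h2 h1; lra.
have etaq : (1 - q) * eta <= 1.
  have -> : (1 - q) * eta = 2 / 3 * (xi_seq M H x k * (a k * b k)).
    by rewrite /q /eta; field; rewrite gt_eqF.
  suff : xi_seq M H x k * (a k * b k) <= xi_seq M H x k.+1 by lra.
  have -> : xi_seq M H x k.+1 = xi_seq M H x k * expR (M * (rp k + r k)).
    by rewrite !xiE -expRD -mulrDr /S big_ord_recr.
  rewrite ler_wpM2l ?(ltW xi0)//; apply: le_trans abexp _; rewrite ler_expR.
  have : 0 <= M * (rp k + r k) by rewrite mulr_ge0// addr_ge0.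
  lra.
have [AJ JB] : loewner_le (H (x k)) (b k *: J k) /\ loewner_le (J k) (b k *: H (x k.+1)).
  by have [_ h1] := J_near k; have [h2 _] := J_near_next k.
(* Since [kappa >= 1], [exp s0 <= 8/7] while [1 + q >= 4/3]. *)
have dq : a k * b k <= 1 + q.
  apply: le_trans ab_E _; rewrite /q.
  have : expR s0 * (7 / 8) <= 1.
    by apply: le_trans E1; rewrite ler_wpM2l ?(ltW E0)//; lra.
  lra.
have eta0 : 0 < eta by apply: mulr_gt0 ab0; exact: mulr_gt0.
have b0 : 0 < b k by lra.
have q01 : 0 < q < 1 by rewrite /q; lra.
have := decrement_contract (g (x k)) (posH (x k)) (posH (x k.+1)) pG (posJ k)
  b0 ab0 eta0 q01 JG' dq GJ' etaq AJ JB.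
rewrite -gradE -!lamE => step.
have q0 : 0 <= q by have /andP[/ltW] := q01.
have bE : expR (M * r k / 2) * b k <= expR s0.
  apply: (@le_trans _ _ (expR (M * r k / 2) * expR (M * r k / 2))).
    by rewrite ler_wpM2l ?expR_ge0.
  by rewrite -expRD ler_expR; lra.
(* With [y = 1 / kappa], [(1 - y/8) (1 - y/2) = 1 - 5y/8 + y^2/16] dominates [q = 1 - 2y/3], and
   [exp s0 (1 - y/8) <= 1] removes the first factor. *)
have Eq : expR s0 * q <= rho.
  apply: (@le_trans _ _ (expR s0 * (1 - kappa^-1 / 8) * (1 - kappa^-1 / 2))).
    rewrite -mulrA ler_wpM2l ?(ltW E0)// /q.
    have : 0 <= kappa^-1 * kappa^-1 by rewrite mulr_ge0// ltW.
    lra.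
  have -> : rho = 1 * (1 - kappa^-1 / 2) by rewrite /rho mul1r; field; rewrite gt_eqF.
  by rewrite ler_wpM2r//; lra.
have h1 : expR (M * rp k.+1 / 2) * lam k.+1 <= expR s0 * q * lam k.
  apply: (@le_trans _ _ (expR (M * r k / 2) * (b k * q * lam k))).
    by rewrite ler_wpM2l ?expR_ge0.
  by rewrite !mulrA ler_wpM2r// ler_wpM2r.
apply: (le_trans h1); apply: (@le_trans _ _ (rho * lam k)).
  by rewrite ler_wpM2r.
rewrite exprS -mulrA ler_wpM2l//; apply: le_trans lamk.
by rewrite ler_peMl// (le_trans a1).
Qed.

Let invariantS k : invariant k -> invariant k.+1.
Proof.
move=> inv; have rk := r_le inv; have [sG JG GJ [lamk rp0] _] := inv.
have a1 := a_ge1 k; have b1 := b_ge1 k.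
have ab1 : 1 <= a k * b k by rewrite -[leLHS]mulr1 ler_pM.
have xi0 : 0 < xi_seq M H x k by rewrite xiE expR_gt0.
have JJp : loewner_le (J k) ((a k * b k) *: Jp k).
  have [h1 _] := J_near k; have [_ h2] := Jp_near k.
  by rewrite mulrC; apply: loewner_comp h1 h2; lra.
have JpJ : loewner_le (Jp k) ((a k * b k) *: J k).
  have [_ h1] := J_near k; have [h2 _] := Jp_near k.
  by apply: loewner_comp h2 h1; lra.
have pJ v := posdef_ge0 v (posJ k).
have eta0 : 0 <= xi_seq M H x k * kappa by rewrite mulr_ge0// ltW.
have GtE : Gtilde M H x G k = (a k * b k) *: G k by [].
have [lo hi] := SR1_bounds (step_u x k) (proj1 (posJ k)) sG pJ ab1 eta0 JJp JpJ JG GJ.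
rewrite -GtE -GS in lo; rewrite -GtE -GS in hi.
split.
- rewrite GS; apply: sym_SR1; first exact: (proj1 (posJ k)).
  by rewrite GtE linearZ/= sG.
- exact: lo.
(* The loss [(a k * b k)^2] is at most [exp (M (rp k + r k))], exactly the growth of [xi] from [k]
   to [k.+1]. *)
- apply: loewner_weaken _ hi; first exact: pJ.
  have -> : xi_seq M H x k.+1 = expR (M * (rp k + r k)) * xi_seq M H x k.
    by rewrite !xiE -expRD -mulrDr /S big_ord_recr/= addrC.
  rewrite -mulrA ler_wpM2r//.
  have -> : M * (rp k + r k) = (M * rp k / 2 + M * r k / 2) * 2 by field.
  rewrite expRM_natr lerXn2r ?nnegrE ?expR_ge0//; first lra.
  by rewrite expRD ler_pM ?expR_ge1Dx//; lra.
- split; first exact: lam_step.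
  by apply: le_trans rk _; have /andP[h1 h2] := rhok k; rewrite ler_piMl.
- exact: S_step.
Qed.

Lemma sr1_convergence k :
  [/\ loewner_le (J_prev H x k) (G k),
      loewner_le (G k) ((xi_seq M H x k * (L / mu)) *: J_prev H x k),
      expR (M * r_prev H x k / 2) * newton_decr g H (x k)
        <= (1 - 1 / (2 * (L / mu))) ^+ k * newton_decr g H (x 0%N),
      r_seq H x k <= (1 - 1 / (2 * (L / mu))) ^+ k * newton_decr g H (x 0%N)
    & xi_seq M H x k <= 3 / 2].
Proof.
have inv : invariant k by elim: k => [|k]; [exact: invariant0|exact: invariantS].
have rk := r_le inv; have [_ JG GJ [lamk _] Sk] := inv.
by split=> //; exact: xi_le.
Qed.

End Convergence.

Theorem theorem3 (R : realType) (n : nat)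
  (f : 'cV[R]_n -> R) (g : 'cV[R]_n -> 'cV[R]_n) (H : 'cV[R]_n -> 'M[R]_n)
  (mu L M : R)
  (x : nat -> 'cV[R]_n) (G : nat -> 'M[R]_n) :
  is_gradient f g -> is_hessian g H ->
  0 < mu -> mu <= L ->
  (forall y, loewner_le (mu%:M) (H y) /\ loewner_le (H y) (L%:M)) ->
  0 <= M -> strongly_self_concordant H M ->
  G 0%N = L%:M ->
  (forall k, x k.+1 = x k - invmx (G k) *m g (x k)) ->
  (forall k, G k.+1 = SR1 (J_seq H x k) (Gtilde M H x G k) (step_u x k)) ->
  M * newton_decr g H (x 0%N) <= ln (3 / 2) / (4 * (L / mu)) ->
  forall k : nat,
    [/\ loewner_le (J_prev H x k) (G k),
        loewner_le (G k) ((xi_seq M H x k * (L / mu)) *: J_prev H x k),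
        expR (M * r_prev H x k / 2) * newton_decr g H (x k)
          <= (1 - 1 / (2 * (L / mu))) ^+ k * newton_decr g H (x 0%N),
        r_seq H x k <= (1 - 1 / (2 * (L / mu))) ^+ k * newton_decr g H (x 0%N)
      & xi_seq M H x k <= 3 / 2].
Proof.
move=> fg gH mu0 muL HmuL M0 scH G0 xS GS start k.
exact: (sr1_convergence gH (hessian_sym fg gH) mu0 muL M0 HmuL scH G0 xS GS start).
Qed.
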